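(* Let $\mathcal X\subseteq\mathbb R^d$, and let $f:\mathbb R^+\to\mathbb R$ be a convex lower semi-continuous function with $f(1)=0$, with associated $f$-divergence $\mathcal D_f$. For any probability measures $P,\widehat P$ on $\mathcal X$, supported on all of $\mathcal X$, with densities $p,\hat p$, and any $\lambda\in\mathbb R^+$, $$\mathcal D_f(P\Vert\widehat P)=\int_m^M\frac{1}{\lambda^3}\,f''\!\left(\frac1\lambda\right)\mathcal D_{\lambda\text{-PR}}(P\Vert\widehat P)\,d\lambda,$$ where $$m=\min_{x\in\mathcal X}\left(\frac{\hat p(x)}{p(x)}\right),\qquad M=\max_{x\in\mathcal X}\left(\frac{\hat p(x)}{p(x)}\right).$$
   Context: For a convex lower semi-continuous function $f:\mathbb R^+\to\mathbb R$ with $f(1)=0$, the $f$-divergence is $\mathcal D_f(P\Vert\widehat P)=\int_{\mathcal X}\hat p(x)\,f\!\left(\frac{p(x)}{\hat p(x)}\right)dx$. For $\lambda\in\mathbb R^+$, the PR-divergence $\mathcal D_{\lambda\text{-PR}}$ is the $f_\lambda$-divergence $\mathcal D_{f_\lambda}$ for $f_\lambda:\mathbb R^+\to\mathbb R$, $f_\lambda(u)=\max(\lambda u,1)-\max(\lambda,1)$. In the displayed formula $\lambda$ is the variable of integration, and $f''$ denotes the second derivative of $f$.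
   Formalization: The formal theorem additionally assumes that f is twice differentiable at every point of R^+ (f'' need not be continuous); for merely convex lower semi-continuous f, such as f(u)=|u-1|, f'' is undefined and the formula fails if f'' is read almost everywhere. *)

(* Defs.v *)
From HB Require Import structures.
From mathcomp Require Import all_boot all_order all_algebra.
From mathcomp Require Import all_classical all_reals all_analysis.

Set Implicit Arguments.
Unset Strict Implicit.
Unset Printing Implicit Defensive.

Import Order.TTheory GRing.Theory Num.Theory.
Import numFieldNormedType.Exports.

Local Open Scope classical_set_scope.
Local Open Scope ring_scope.

(* R^d, with the product (Borel) sigma-algebra. *)
Notation Rd R d := (d.-tuple (measurableTypeR R)).

(* The library gives m1 \x m2 no sigma-finite instance. *)
Lemma sigma_finite_product d1 d2 (T1 : measurableType d1)
    (T2 : measurableType d2) (R : realType)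
    (m1 : {sigma_finite_measure set T1 -> \bar R})
    (m2 : {sigma_finite_measure set T2 -> \bar R}) :
  sigma_finite setT (m1 \x m2)%E.
Proof.
have /sigma_finiteP[F [TF ndF Foo]] := sigma_finiteT m1.
have /sigma_finiteP[G [TG ndG Goo]] := sigma_finiteT m2.
exists (fun n => F n `*` G n).
  rewrite -setXTT TF TG predeqE => -[x y]; split.
    move=> [/= [n _ Fnx] [k _ Gky]]; exists (maxn n k) => //; split.
    - by move: x Fnx; exact/subsetPset/ndF/leq_maxl.
    - by move: y Gky; exact/subsetPset/ndG/leq_maxr.
  by move=> [n _ []/= ? ?]; split; exists n.
move=> k; have [? ?] := Foo k; have [? ?] := Goo k.
split; first exact: measurableX.
by rewrite product_measure1E// lte_mul_pinfty// ge0_fin_numE.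
Qed.

Section lebesgue_Rd.
Context (R : realType).
Local Open Scope ereal_scope.

Definition consRd (d : nat) (z : measurableTypeR R * Rd R d) : Rd R d.+1 :=
  [the Rd R d.+1 of z.1 :: z.2].

Lemma measurable_consRd d : measurable_fun setT (@consRd d).
Proof. exact: (measurable_cons measurable_fst measurable_snd). Qed.

Let lebesgue_Rd0 : set (Rd R 0) -> \bar R := dirac ([tuple] : Rd R 0).

Let lebesgue_Rd0_sigma_finite : sigma_finite setT lebesgue_Rd0.
Proof.
apply: fin_num_fun_sigma_finite; last first.
  by move=> A mA; rewrite /lebesgue_Rd0 diracE.
by rewrite /lebesgue_Rd0 diracE ltry.
Qed.

HB.instance Definition _ := Measure.on lebesgue_Rd0.
HB.instance Definition _ := Measure_isSigmaFinite.Build _ _ _ lebesgue_Rd0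
  lebesgue_Rd0_sigma_finite.

Section step.
Variables (d : nat) (mu : {sigma_finite_measure set (Rd R d) -> \bar R}).

Let lebesgue_RdS : set (Rd R d.+1) -> \bar R :=
  pushforward (lebesgue_measure \x mu)%E (@consRd d).

Let lebesgue_RdS0 : lebesgue_RdS set0 = 0.
Proof. by rewrite /lebesgue_RdS /pushforward preimage_set0 measure0. Qed.

Let lebesgue_RdS_ge0 A : 0 <= lebesgue_RdS A.
Proof. by rewrite /lebesgue_RdS /pushforward measure_ge0. Qed.

Let lebesgue_RdS_sigma_additive : semi_sigma_additive lebesgue_RdS.
Proof.
exact: (@measure_semi_sigma_additive _ _ _
  (measure_function_pushforward__canonical__measure_function_Measure
     _ (@measurable_consRd d))).
Qed.

HB.instance Definition _ := isMeasure.Build _ _ _ lebesgue_RdS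
  lebesgue_RdS0 lebesgue_RdS_ge0 lebesgue_RdS_sigma_additive.

Let lebesgue_RdS_sigma_finite : sigma_finite setT lebesgue_RdS.
Proof.
have [F FT Foo] := sigma_finite_product (@lebesgue_measure R) mu.
pose g (t : Rd R d.+1) : measurableTypeR R * Rd R d :=
  (thead t, [tuple of behead t]).
have gK (z : measurableTypeR R * Rd R d) : g (consRd z) = z.
  by case: z => x t; rewrite /g /consRd /= theadE; congr pair; exact: val_inj.
have mg : measurable_fun setT g.
  apply/measurable_fun_pairP; split; first exact: measurable_tnth.
  exact: measurable_behead.
exists (fun i => g @^-1` F i).
  by rewrite -preimage_bigcup -FT preimage_setT.
move=> i; have [mF Fi] := Foo i; split.
  by rewrite -[X in measurable X]setTI; exact: mg.
rewrite /lebesgue_RdS /pushforward -comp_preimage.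
by rewrite (_ : g \o _ = id) ?preimage_id//; apply/funext => z /=; rewrite gK.
Qed.

HB.instance Definition _ := Measure_isSigmaFinite.Build _ _ _ lebesgue_RdS
  lebesgue_RdS_sigma_finite.

Definition lebesgue_Rd_step :
  {sigma_finite_measure set (Rd R d.+1) -> \bar R} := lebesgue_RdS.

End step.

(* Lebesgue measure on R^d: the d-fold product of the Lebesgue measure on R. *)
Fixpoint lebesgue_Rd (d : nat) : {sigma_finite_measure set (Rd R d) -> \bar R} :=
  match d with
  | 0%N => lebesgue_Rd0
  | d.+1 => lebesgue_Rd_step (lebesgue_Rd d)
  end.

Lemma lebesgue_Rd_box d (A : 'I_d -> set (measurableTypeR R)) :
  (forall i, measurable (A i)) ->
  lebesgue_Rd d [set t | forall i, A i (tnth t i)] =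
    \prod_(i < d) lebesgue_measure (A i).
Proof.
elim: d A => [|d IH] A mA.
  by rewrite big_ord0 /= /lebesgue_Rd0 diracE mem_set//= => -[].
rewrite big_ord_recl -IH//.
set B := [set t : Rd R d | _].
have mB : measurable B.
  rewrite (_ : B = \bigcap_(i in [set: 'I_d])
      ((@tnth _ (measurableTypeR R))^~ i @^-1` A (lift ord0 i))); last first.
    by apply/seteqP; split => [t Bt i _|t Bt i]; [exact: Bt|exact: (Bt i I)].
  apply: fin_bigcap_measurable => // i _.
  by rewrite -[X in measurable X]setTI; exact: measurable_tnth.
rewrite -product_measure1E//= /pushforward.
congr ((_ \x _)%E _); apply/seteqP; split => [[x t] /= H|[x t] [/= A0 At] i].
  by split=> [|i]; [have := H ord0|have := H (lift ord0 i)];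
    rewrite ?tnth0 ?tnthS.
by have [j ->|->] := unliftP ord0 i; rewrite ?tnth0 ?tnthS//; exact: At.
Qed.

End lebesgue_Rd.

Section divergences.
Context (R : realType) (d : nat).
Implicit Types (X : set (Rd R d)) (f : R -> R) (p q : Rd R d -> R).

Definition is_density (P : set (Rd R d) -> \bar R) p :=
  [/\ measurable_fun setT (p : Rd R d -> measurableTypeR R),
      forall x, 0 <= p x &
      forall A, measurable A -> P A = (\int[lebesgue_Rd R d]_(x in A) (p x)%:E)%E].

(* Support in the pointwise sense, so that q x / p x and p x / q x are defined and
   positive at every point x of the common support of p and q. *)
Definition density_support p : set (Rd R d) := [set x | 0 < p x].

Definition f_divergence X f p q : \bar R :=
  (\int[lebesgue_Rd R d]_(x in X) (q x * f (p x / q x))%:E)%E.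

Definition f_PR (lambda : R) : R -> R :=
  fun u => Num.max (lambda * u) 1 - Num.max lambda 1.

Definition PR_divergence X (lambda : R) p q : \bar R :=
  f_divergence X (f_PR lambda) p q.

End divergences.

(* f : R^+ -> R is represented by a total f : R -> R whose values outside
   ]0, +oo[ are unconstrained. *)
Definition posreals (R : realType) : set R := `]0, +oo[.
Arguments posreals R : clear implicits.

Definition convex_on_posreals (R : realType) (f : R -> R) :=
  convex_function (E := R^o) (posreals R) f.

(* With the subspace topology, semicontinuity at points outside ]0, +oo[ is void. *)
Definition lsc_on_posreals (R : realType) (f : R -> R) :=
  lower_semicontinuous ((EFin \o f) : subspace (posreals R) -> \bar R).

Definition twice_derivable_on_posreals (R : realType) (f : R -> R) :=
  forall u, u \in posreals R -> derivable f u 1 /\ derivable (derive1 f) u 1.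

Definition is_minimum (R : realType) (T : Type) (X : set T) (g : T -> R) (m : R) :=
  (g @` X) m /\ lbound (g @` X) m.

Definition is_maximum (R : realType) (T : Type) (X : set T) (g : T -> R) (M : R) :=
  (g @` X) M /\ ubound (g @` X) M.

(* Main.v *)
Require Import Defs.
From mathcomp Require Import all_boot all_order all_algebra.
From mathcomp Require Import all_classical all_reals all_analysis.
From mathcomp Require Import measurable_realfun ring lra.

(** With u = p / phat, the integrand of the PR-divergence, minus a multiple of
    p - phat (which integrates to 0), is nonnegative, so Tonelli's theorem reduces
    the identity to a pointwise one:
    the integral over [m, M] of f''(1/l) / l^3 times the corrected f_l(u) is
    f(u) - f'(1) (u - 1).  In l, the integrand is supported between 1 and 1/u, where
    it is, up to sign, the derivative of f'(1/l) (u - 1/l) + f(1/l).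
    As f'' need not be continuous, this uses the fundamental theorem of calculus for
    an everywhere existing nonnegative derivative, proved by comparing increments
    with the integral of a local majorant of the derivative. *)

Set Implicit Arguments.
Unset Strict Implicit.

Import Order.TTheory GRing.Theory Num.Theory.
Import numFieldNormedType.Exports.

Local Open Scope classical_set_scope.
Local Open Scope ring_scope.

(** * Fundamental theorem of calculus for nonnegative, possibly discontinuous derivatives *)

(** Let [c] be the supremum of the points [x] with [h a <= h x]. Comparison with points just left of
    [c] puts [c] itself in this set, and comparison with points just right of [c] would produce a
    larger member unless [c = b]. *)
Lemma locally_nondecreasing_le (R : realType) (h : R -> R) (a b : R) :
  a <= b ->
  (forall x, x \in `[a, b] -> \forall y \near x, y \in `[a, b] ->
     (x <= y -> h x <= h y) /\ (y <= x -> h y <= h x)) ->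
  h a <= h b.
Proof.
move=> ab hloc; pose S := [set x | x \in `[a, b] /\ h a <= h x].
have Sa : S a by split => //; rewrite in_itv/= lexx.
have supS : has_sup S.
  by split; [exists a|exists b => x [/itvP xab _]; rewrite xab].
set c := sup S.
have cab : c \in `[a, b].
  rewrite in_itv/= ub_le_sup ?ge_sup//; last by case: supS.
  - by exists a.
  - by move=> x [/itvP xab _]; rewrite xab.
have /nbhs_ballP[r/= r0 rP] := hloc c cab.
have Sc : h a <= h c.
  have [y Sy cry] := sup_adherent r0 supS.
  have yc : y <= c by apply: ub_le_sup => //; case: supS.
  have cyr : ball c r y by rewrite /ball/= ger0_norm ?subr_ge0//; rewrite /c; lra.
  by case: Sy => yab hay; have [_ /(_ yc)] := rP y cyr yab; exact: le_trans.
have [bc|cb] := leP b c.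
  by have -> : b = c by apply/eqP; rewrite eq_le bc (itvP cab).
pose y := Num.min b (c + r / 2).
have cy : c < y by rewrite /y lt_min cb/= ltrDl divr_gt0.
have yab : y \in `[a, b].
  by rewrite in_itv/= /y ge_min lexx/= andbT (le_trans _ (ltW cy))// (itvP cab).
have cyr : ball c r y.
  rewrite /ball/= ltr0_norm ?subr_lt0// opprB.
  have : y <= c + r / 2 by rewrite /y ge_min lexx orbT.
  lra.
have [/(_ (ltW cy)) hcy _] := rP y cyr yab.
have : y <= c.
  apply: ub_le_sup; first by case: supS.
  by split => //; exact: le_trans hcy.
by rewrite leNgt cy.
Qed.

(* Vitali-Caratheodory: w is a countable sum of multiples of indicators of open
   neighbourhoods of the level sets of D. *)
Lemma integrable_local_majorant (R : realType) (a b : R) (D : R -> R) (e : R) :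
  a <= b -> measurable_fun `[a, b] D -> (forall x, x \in `[a, b] -> 0 <= D x) ->
  0 < e ->
  exists w : R -> \bar R, [/\ measurable_fun setT w, forall x, (0 <= w x)%E,
    (\int[lebesgue_measure]_(x in `[a, b]) w x <=
     \int[lebesgue_measure]_(x in `[a, b]) (D x)%:E +
       ((2 * (b - a) + 1) * e)%:E)%E &
    forall x, x \in `[a, b] -> exists2 c, D x < c &
      \forall y \near x, (c%:E <= w y)%E].
Proof.
move=> ab mD D0 e0; pose mu := @lebesgue_measure R.
(* On the level set [E k] the value of [D] lies in [[k * e, (k + 1) * e[], so [c k] is strictly
   above [D] there but at most [D + 2 * e]; this costs [2 * (b - a) * e] in the integral. *)
pose c (k : nat) := k.+2%:R * e.
have c0 k : 0 < c k by rewrite mulr_gt0.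
pose E (k : nat) := `[a, b] `&` D @^-1` `[k%:R * e, k.+1%:R * e[.
have mE k : measurable (E k) by apply: mD => //; exact: measurable_itv.
have muab : (mu `[a, b]%classic = (b - a)%:E)%E.
  rewrite /mu lebesgue_measure_itv/= lte_fin.
  by have [//|ba] := ltP a b; rewrite (_ : b = a) ?subrr//; apply/le_anti/andP.
have mle (A B : set R) : measurable A -> measurable B -> A `<=` B ->
    (mu A <= mu B)%E.
  by move=> mA mB AB; apply: le_measure => //; exact: mem_set.
have Efin k : (mu (E k) < +oo)%E.
  rewrite (@le_lt_trans _ _ (mu `[a, b]%classic))//; last by rewrite muab ltry.
  by apply: mle => // x [].
(* With this choice [c k * dl k = e / 2 ^ (k + 1)], so enlarging all level sets to open sets costs
   at most [e] in total. *)
pose dl (k : nat) := e / (2 ^ k.+1)%:R / c k.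
have dl0 k : 0 < dl k by rewrite !divr_gt0// ltr0n expn_gt0.
have /choice[V VP] k := lebesgue_regularity_outer (mE k) (Efin k) (dl0 k).
have mV k : measurable (V k) by apply: open_measurable; case: (VP k).
pose t k x := (c k * \1_(V k) x)%:E.
have t0 k x : (0 <= t k x)%E by rewrite lee_fin mulr_ge0// ltW.
have mc (A B : set R) k : measurable A ->
    measurable_fun B (fun x => (c k * \1_A x)%:E).
  by move=> mA; apply/measurable_EFinP/measurable_funM.
have mt k : measurable_fun setT (t k) by exact: mc.
have intc (A : set R) k : measurable A ->
    (\int[mu]_(x in `[a, b]) (c k * \1_A x)%:E = (c k)%:E * mu (A `&` `[a, b]))%E.
  move=> mA; under eq_integral do rewrite EFinM.
  rewrite ge0_integralZl_EFin ?integral_indic//; last exact: ltW.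
  by apply/measurable_EFinP; exact: measurable_indic.
exists (fun x => \sum_(k <oo) t k x)%E; split.
- by apply: ge0_emeasurable_sum.
- by move=> x; apply: nneseries_ge0 => k _ _; exact: t0.
- rewrite integral_nneseries//.
  have step1 : (\sum_(k <oo) \int[mu]_(x in `[a, b]) t k x <=
      \sum_(k <oo) (((c k)%:E * mu (E k)) + (e / (2 ^ k.+1)%:R)%:E))%E.
    apply: lee_nneseries => [k _ _|k _]; first exact: integral_ge0.
    rewrite intc//; have [_ EV Vd] := VP k.
    have -> : (e / (2 ^ k.+1)%:R)%:E = ((c k)%:E * (dl k)%:E)%E.
      by rewrite -EFinM /dl [in RHS]mulrCA divff ?mulr1// gt_eqF.
    rewrite -ge0_muleDr//; last by rewrite lee_fin ltW.
    rewrite lee_pmul2l ?lte_fin//.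
    apply: (@le_trans _ _ (mu (E k) + mu (V k `\` E k))%E).
      rewrite -measureU//; last 3 first.
      + exact: mE.
      + by apply: measurableD; [exact: mV|exact: mE].
      + by rewrite setDIK.
      rewrite setDUK//; apply: mle => //.
      exact: measurableI.
    by rewrite leeD2l// ltW.
  apply: (le_trans step1).
  apply: (le_trans (epsilon_trick _ _ _)) => //.
  + by move=> k; rewrite mule_ge0// lee_fin ltW.
  + exact: ltW.
  rewrite mulrDl mul1r EFinD addeA leeD2r//.
  have -> : (\sum_(k <oo) (c k)%:E * mu (E k) =
      \int[mu]_(x in `[a, b]) \sum_(k <oo) (c k * \1_(E k) x)%:E)%E.
    rewrite integral_nneseries//.
    + apply: eq_eseriesr => k _; rewrite intc//; congr (_ * mu _)%E.
      by rewrite setIC /E setIA setIid.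
    + by move=> k; exact: mc.
    + by move=> k x _; rewrite lee_fin mulr_ge0// ltW.
  have -> : (2 * (b - a) * e)%:E = (\int[mu]_(x in `[a, b]) (2 * e)%:E)%E.
    by rewrite integral_cst//= [X in (_ * X)%E]muab -EFinM mulrAC.
  rewrite -ge0_integralD//; last 2 first.
  + exact/measurable_EFinP.
  + by move=> x _; rewrite lee_fin mulr_ge0// ltW.
  apply: ge0_le_integral => //.
  + by move=> x _; apply: nneseries_ge0 => k _ _; rewrite lee_fin mulr_ge0// ltW.
  + apply: ge0_emeasurable_sum => [k x _ _|k _].
      by rewrite lee_fin mulr_ge0// ltW.
    by exact: mc.
  + by apply: emeasurable_funD => //; exact/measurable_EFinP.
  (* The level sets are disjoint, so at [x] the series collapses to the term indexed by the integer
     part of [D x / e]. *)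
  move=> x xab; have Dx := D0 _ xab.
  have /truncn_itv : 0 <= D x / e by rewrite divr_ge0// ltW.
  set k := Num.trunc _; rewrite ler_pdivlMr// ltr_pdivrMr// => /andP[kD Dk].
  have uniqk j : E j x -> j = k.
    move=> [_ /=]; rewrite in_itv/= => /andP[jD Dj].
    have H1 : (k < j.+1)%N.
      by rewrite -(ltr_nat R) -(ltr_pM2r e0); exact: le_lt_trans Dj.
    have H2 : (j < k.+1)%N.
      by rewrite -(ltr_nat R) -(ltr_pM2r e0); exact: le_lt_trans Dk.
    by apply/eqP; rewrite eqn_leq; apply/andP; split; rewrite -ltnS.
  rewrite (@nneseriesD1 _ _ k)//; last first.
    by move=> j _; rewrite lee_fin mulr_ge0// ltW.
  rewrite eseries0 ?adde0; last first.
    move=> j _ /= /eqP jk; rewrite indicE memNset ?mulr0//.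
    by move/uniqk.
  rewrite -EFinD lee_fin indicE mem_set; last by split => //=; rewrite in_itv/= kD.
  by rewrite mulr1 /c -!natr1 !mulrDl mul1r; lra.
- by move=> k; exact: mc.
- move=> x xab; have Dx := D0 _ xab.
  have /truncn_itv : 0 <= D x / e by rewrite divr_ge0// ltW.
  set k := Num.trunc _; rewrite ler_pdivlMr// ltr_pdivrMr// => /andP[kD Dk].
  exists (c k).
    by rewrite (lt_le_trans Dk)// ler_pM2r// ler_nat.
  have [oV EV _] := VP k.
  have Vx : V k x by apply: EV; split => //=; rewrite in_itv/= kD.
  have := open_nbhs_nbhs (conj oV Vx); apply: filterS => y Vy.
  rewrite (@nneseriesD1 _ _ k)//.
  rewrite {1}/t indicE mem_set// mulr1 leeDl//.
  by apply: nneseries_ge0 => j _ _; exact: t0.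
Qed.

(** Take a local majorant [w] of [E] whose integral exceeds that of [E] by at most [eps], with
    primitive [W]. Near each [x], [w] stays above some [c > E x >= D x] while the slopes of [h] from
    [x] stay below [c], so [W - h] is locally nondecreasing; then let [eps] tend to 0. *)
Lemma increment_le_integral (R : realType) (h D E : R -> R) (a b : R) :
  a <= b -> measurable_fun `[a, b] E -> (forall x, x \in `[a, b] -> 0 <= E x) ->
  (forall x, x \in `[a, b] -> is_derive x 1 h (D x) /\ D x <= E x) ->
  ((h b - h a)%:E <= \int[lebesgue_measure]_(x in `[a, b]) (E x)%:E)%E.
Proof.
move=> ab mE E0 hE.
set I := (\int[_]_(x in _) _)%E.
(* A finite integral is what makes the primitive [W] below real-valued, so that [fine] loses nothing
   on [[a, b]]. *)
have [->|Ify] := eqVneq I +oo%E; first by rewrite leey.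
have I0 : (0 <= I)%E.
  by apply: integral_ge0 => x xab; rewrite lee_fin E0.
apply/lee_addgt0Pr => eps eps0.
have K0 : 0 < 2 * (b - a) + 1 by lra.
have [w [mw w0 intw locw]] := integrable_local_majorant ab mE E0 (divr_gt0 eps0 K0).
move: intw; rewrite mulrCA divff ?gt_eqF// mulr1 => intw.
have wb : (\int[lebesgue_measure]_(x in `[a, b]) w x < +oo)%E.
  by apply: le_lt_trans intw _; rewrite lte_add_pinfty ?ltry// ltey.
apply: le_trans intw.
pose W x := fine (\int[lebesgue_measure]_(z in `[a, x]) w z)%E.
have Wfin x : x \in `[a, b] ->
    (\int[lebesgue_measure]_(z in `[a, x]) w z)%E \is a fin_num.
  move=> xab; rewrite ge0_fin_numE ?integral_ge0//.
  apply: le_lt_trans wb; apply: ge0_subset_integral => //.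
    exact: measurable_funTS.
  by apply: subset_itvl; rewrite bnd_simp (itvP xab).
have Wge s t c : s \in `[a, b] -> t \in `[a, b] -> s <= t -> 0 <= c ->
    (forall z, z \in `]s, t] -> (c%:E <= w z)%E) -> c * (t - s) <= W t - W s.
  move=> sab tab st c0 cw.
  rewrite lerBrDr -lee_fin EFinD /W !fineK; [|exact: Wfin|exact: Wfin].
  have -> : `[a, t]%classic = `[a, s] `|` `]s, t].
    rewrite -itv_bndbnd_setU// bnd_simp//; first by rewrite (itvP sab).
  rewrite ge0_integral_setU//; last 2 first.
  - exact: measurable_funTS.
  - apply/disj_setPS => z [/=]; rewrite !in_itv/= => /andP[_ zs] /andP[sz _].
    by move: sz; rewrite ltNge zs.
  rewrite addeC leeD2l//.
  have -> : (c * (t - s))%:E = (\int[lebesgue_measure]_(x in `]s, t]) c%:E)%E.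
    rewrite integral_cst//= lebesgue_measure_itv/= lte_fin.
    have [//|ts] := ltP s t.
    by rewrite (_ : t = s) ?subrr ?mule0 ?mulr0//; apply/le_anti/andP.
  apply: ge0_le_integral => //.
  exact: measurable_funTS.
have : W a - h a <= W b - h b.
  apply: (@locally_nondecreasing_le _ (fun x => W x - h x)) => // x xab.
  have [dh hx] := hE _ xab.
  have [c Ec cw] := locw _ xab.
  have /is_derive1_caratheodory[g [hg cg gx]] := dh.
  have c0 : 0 <= c by apply: le_trans (ltW Ec); exact: E0.
  have gc : \forall y \near x, g y < c.
    apply: (cvgr_lt (g x) cg); rewrite gx; exact: le_lt_trans Ec.
  have /nbhs_ballP[r/= r0 rP] : \forall y \near x, g y < c /\ (c%:E <= w y)%E.
    by apply: filterS2 gc cw.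
  apply/nbhs_ballP; exists r => //= y xyr yab.
  have [gy _] := rP _ xyr.
  have hyx := hg y.
  split=> [xy|yx].
  - have := Wge x y c xab yab xy c0.
    have -> : W y - W x = (W y - h y) - (W x - h x) + g y * (y - x).
      by rewrite -hyx; ring.
    move=> H.
    have {}H : c * (y - x) <= (W y - h y) - (W x - h x) + g y * (y - x).
      apply: H => z /itvP zxy; have [] := rP z => //.
      move: xyr; rewrite /ball/= !ler0_norm ?subr_le0 ?zxy//.
      by apply: le_lt_trans; rewrite lerN2 lerB// zxy.
    have : g y * (y - x) <= c * (y - x) by rewrite ler_wpM2r ?subr_ge0// ltW.
    lra.
  - have := Wge y x c yab xab yx c0.
    have -> : W x - W y = (W x - h x) - (W y - h y) - g y * (y - x).
      by rewrite -hyx; ring.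
    move=> H.
    have {}H : c * (x - y) <= (W x - h x) - (W y - h y) - g y * (y - x).
      apply: H => z /itvP zxy; have [] := rP z => //.
      move: xyr; rewrite /ball/= !ger0_norm ?subr_ge0 ?zxy//.
      by apply: le_lt_trans; rewrite lerB// zxy.
    have : g y * (x - y) <= c * (x - y) by rewrite ler_wpM2r ?subr_ge0// ltW.
    lra.
have Wa : 0 <= W a by rewrite fine_ge0// integral_ge0.
have <- : (W b)%:E = (\int[lebesgue_measure]_(x in `[a, b]) w x)%E.
  by rewrite /W fineK// Wfin// in_itv/= lexx ab.
rewrite lee_fin; lra.
Qed.

(* The upper bound is [increment_le_integral] applied to n x - g x and the
   truncations n - min (D, n). *)
Lemma integral_derivative (R : realType) (g D : R -> R) (a b : R) :
  a <= b -> measurable_fun `[a, b] D -> (forall x, x \in `[a, b] -> 0 <= D x) ->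
  (forall x, x \in `[a, b] -> is_derive x 1 g (D x)) ->
  (\int[lebesgue_measure]_(x in `[a, b]) (D x)%:E)%E = (g b - g a)%:E.
Proof.
move=> ab mD D0 dg; apply/eqP; rewrite eq_le; apply/andP; split; last first.
  by apply: increment_le_integral => // x xab; split; [exact: dg|].
pose T n x := Num.min (D x) n%:R.
have mT n : measurable_fun `[a, b] (T n) by exact: measurable_minr.
have T0 n x : x \in `[a, b] -> 0 <= T n x by move=> /D0 Dx; rewrite le_min Dx/=.
have intT n :
    (\int[lebesgue_measure]_(x in `[a, b]) (T n x)%:E <= (g b - g a)%:E)%E.
  have nT x : x \in `[a, b] -> 0 <= n%:R - T n x.
    by move=> _; rewrite subr_ge0 /T ge_min lexx orbT.
  have mnT : measurable_fun `[a, b] (fun x => n%:R - T n x).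
    by apply: measurable_funB.
  have H : ((n%:R * b - g b - (n%:R * a - g a))%:E <=
      \int[lebesgue_measure]_(x in `[a, b]) (n%:R - T n x)%:E)%E.
    apply: (@increment_le_integral _ (fun x => n%:R * x - g x)
      (fun x => n%:R - D x)) => // x xab; split.
      have dx := dg _ xab.
      by apply: is_derive_eq; rewrite /GRing.scale/= mulr1.
    by rewrite lerB// /T ge_min lexx.
  have : (\int[lebesgue_measure]_(x in `[a, b]) (n%:R - T n x)%:E +
      \int[lebesgue_measure]_(x in `[a, b]) (T n x)%:E = (n%:R * (b - a))%:E)%E.
    rewrite -ge0_integralD//; last 3 first.
    - exact/measurable_EFinP.
    - by move=> x xab; rewrite lee_fin T0.
    - by apply/measurable_EFinP; exact: mT.
    under eq_integral do rewrite -EFinD subrK.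
    rewrite integral_cst//= lebesgue_measure_itv/= lte_fin.
    have [//|ba] := ltP a b.
    by rewrite (_ : b = a) ?subrr ?mule0 ?mulr0//; apply/le_anti/andP.
  move: H; set A := (\int[_]_(x in _) _)%E; set B := (\int[_]_(x in _) _)%E.
  have : (0 <= A)%E by apply: integral_ge0 => x xab; rewrite lee_fin nT.
  have : (0 <= B)%E by apply: integral_ge0 => x xab; rewrite lee_fin T0.
  case: B => [B| |]//; case: A => [A| |]// _ _.
  rewrite !lee_fin -EFinD => H [AB]; lra.
(* For fixed [x], [T n x] increases with [n] and equals [D x] once [n] exceeds [D x]; monotone
   convergence carries the bound over to [D]. *)
have -> : (\int[lebesgue_measure]_(x in `[a, b]) (D x)%:E =
    \int[lebesgue_measure]_(x in `[a, b]) limn (fun n => (T n x)%:E))%E.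
  apply: eq_integral => x _; apply/esym/cvg_lim => //; apply: cvg_near_cst.
  exists (Num.trunc (D x)).+1 => // n /= nD.
  rewrite /T min_l//; apply: ltW; apply: lt_le_trans (truncnS_gt _) _.
  by rewrite ler_nat.
rewrite monotone_convergence//.
- apply: lime_le; last by apply: nearW => n; exact: intT.
  apply: ereal_nondecreasing_is_cvgn => n k nk.
  apply: ge0_le_integral => //.
  - by move=> x xab; rewrite lee_fin le_min D0//=.
  - by apply/measurable_EFinP; exact: mT.
  - by apply/measurable_EFinP; exact: mT.
  - by move=> x _; rewrite lee_fin le_min2// ler_nat.
- by move=> n; apply/measurable_EFinP; exact: mT.
- by move=> x _ n k nk; rewrite lee_fin le_min2// ler_nat.
Qed.

(** * Derivatives on the positive half-line: convexity and measurability *)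

(** By Caratheodory's form of the derivative, the quotient is a slope function continuous at [x],
    times [v]. A sequence of steps is used so that inequalities and measurability both pass to the
    limit. *)
Lemma difference_quotient_cvg (R : realType) (f : R -> R) (x l v : R) :
  is_derive x 1 f l ->
  (f (x + v / n.+1%:R) - f x) * n.+1%:R @[n --> \oo] --> l * v.
Proof.
move=> /is_derive1_caratheodory[g [fg cg <-]].
under eq_fun.
  move=> n; rewrite fg addrAC subrr add0r -mulrA divfK ?pnatr_eq0//.
  over.
apply: cvgMl; apply: (@cvg_comp _ _ _ _ g _ (nbhs x)); last exact: cg.
suff : x + v * n.+1%:R^-1 @[n --> \oo] --> x + v * 0 by rewrite mulr0 addr0.
by apply: cvgD; [exact: cvg_cst|apply: cvgMr; exact: cvg_harmonic].
Qed.

Lemma posrealsE (R : realType) (x : R) : (x \in posreals R) = (0 < x).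
Proof. by rewrite mem_setE in_itv/= andbT. Qed.

Section convex_derivative.
Context (R : realType) (f f' : R -> R).
Hypothesis f_convex : convex_on_posreals f.
Hypothesis df : forall x : R, 0 < x -> is_derive x 1 f (f' x).

(** Convexity bounds each quotient [(f (x + t * (y - x)) - f x) / t] with [0 < t <= 1] by
    [f y - f x]; the left-hand side is their limit along [t = 1 / (n + 1)]. *)
Lemma convex_tangent_le (x y : R) : 0 < x -> 0 < y -> f' x * (y - x) <= f y - f x.
Proof.
move=> x0 y0; apply: (cvgr_to_le (difference_quotient_cvg (v := y - x) (df x0))).
apply: nearW => n; set t : R := n.+1%:R^-1.
have t0 : 0 < t by rewrite invr_gt0.
have t1 : t <= 1 by rewrite invf_le1// ler1n.
have H : f (t * y + (1 - t) * x) <= t * f y + (1 - t) * f x.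
  have := f_convex (Itv01 (ltW t0) t1) (x := y) (y := x).
  by rewrite !posrealsE => /(_ y0 x0); rewrite !convRE.
rewrite -ler_pdivlMr// -/t (_ : x + _ = t * y + (1 - t) * x); last by ring.
by apply: le_trans (_ : t * f y + (1 - t) * f x - f x <= _); [rewrite lerB|lra].
Qed.

(** Add the tangent inequalities at [x] and at [y], and divide by [y - x]. *)
Lemma convex_derivative_homo (x y : R) : 0 < x -> x <= y -> f' x <= f' y.
Proof.
rewrite le_eqVlt => x0 /orP[/eqP->//|xy]; have y0 := lt_trans x0 xy.
have := convex_tangent_le x0 y0; have := convex_tangent_le y0 x0.
rewrite -(opprB y x) mulrN => H1 H2.
by rewrite -(@ler_pM2r _ (y - x)) ?subr_gt0//; lra.
Qed.

Lemma convex_derivative2_ge0 (x l : R) : 0 < x -> is_derive x 1 f' l -> 0 <= l.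
Proof.
move=> x0 /(difference_quotient_cvg (v := 1)); rewrite mulr1 => /cvgr_to_ge; apply.
apply: nearW => n; rewrite mulr_ge0// subr_ge0 convex_derivative_homo//.
by rewrite lerDl.
Qed.

End convex_derivative.

(** The derivative is a pointwise limit of difference quotients of a continuous function; the steps
    are positive, so the shifted argument stays in the half-line. *)
Lemma measurable_derivative (R : realType) (f f' : R -> R) :
  (forall x : R, 0 < x -> is_derive x 1 f (f' x)) -> measurable_fun (posreals R) f'.
Proof.
move=> df.
have mf : measurable_fun (posreals R) f.
  apply: open_continuous_measurable_fun => // x; rewrite posrealsE => x0.
  apply: differentiable_continuous; apply/derivable1_diffP.
  by have := df _ x0 => -[].
apply: (@measurable_fun_cvg _ (measurableTypeR R) R (posreals R)
  (fun n x => (f (x + 1 / n.+1%:R) - f x) * n.+1%:R)) => [n|x].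
  apply: measurable_funM => //; apply: measurable_funB => //.
  apply: (@measurable_comp _ _ _ _ _ _ (posreals R)) => //.
    exact: measurable_itv.
  move=> _ [x /mem_set + <-]; rewrite posrealsE => x0.
  by apply: set_mem; rewrite posrealsE addr_gt0.
  exact: measurable_funD.
move=> /mem_set Rx; have x0 : 0 < x by rewrite -posrealsE.
by have := difference_quotient_cvg (v := 1) (df _ x0); rewrite mulr1.
Qed.

(** * The corrected PR-integrand and its integral in [l] at a fixed ratio [u] *)

Lemma integral_support_subset d (T : measurableType d) (R : realType)
    (mu : {measure set T -> \bar R}) (A B : set T) (g : T -> \bar R) :
  A `<=` B -> (forall x, B x -> ~ A x -> g x = 0%E) ->
  (\int[mu]_(x in B) g x = \int[mu]_(x in A) g x)%E.
Proof.
move=> AB g0; rewrite integral_mkcond [RHS]integral_mkcond.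
congr (integral _ _ _); apply/funext => x; rewrite /patch.
have [/set_mem Ax|/negP nAx] := boolP (x \in A).
  by rewrite mem_set//; exact: AB.
case: ifPn => // /set_mem Bx; apply: g0 => // Ax.
by apply: nAx; rewrite mem_set.
Qed.

(* [f_PR l u] minus an affine function of [u] vanishing at 1, chosen so that the
   result is nonnegative; the affine part does not contribute to the divergence. *)
Definition PR_gap (R : realType) (l u : R) : R :=
  f_PR l u - (if l <= 1 then 0 else l) * (u - 1).

Lemma PR_gapE1 (R : realType) (l u : R) : l <= 1 ->
  PR_gap l u = Num.max (l * u) 1 - 1.
Proof. by move=> l1; rewrite /PR_gap /f_PR l1 mul0r subr0 (max_r l1). Qed.

Lemma PR_gapE2 (R : realType) (l u : R) : 1 < l ->
  PR_gap l u = Num.max (l * u) 1 - l * u.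
Proof.
by move=> l1; rewrite /PR_gap /f_PR leNgt l1/= (max_l (ltW l1)); ring.
Qed.

Lemma PR_gap_ge0 (R : realType) (l u : R) : 0 <= PR_gap l u.
Proof.
have [l1|l1] := leP l 1.
  by rewrite PR_gapE1// subr_ge0 le_max lexx orbT.
by rewrite PR_gapE2// subr_ge0 le_max lexx.
Qed.

Section pointwise_formula.
Context (R : realType) (f f' f'' : R -> R).
Hypothesis f_at1 : f 1 = 0.
Hypothesis df : forall x : R, 0 < x -> is_derive x 1 f (f' x).
Hypothesis df' : forall x : R, 0 < x -> is_derive x 1 f' (f'' x).
Hypothesis f''_ge0 : forall x : R, 0 < x -> 0 <= f'' x.

Let k (l : R) := 1 / l ^+ 3 * f'' (1 / l).

(** This is the value at [u] of the tangent to [f] at [1 / l]: it is [f u] at [l = 1 / u], and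
    [f' 1 * (u - 1)] at [l = 1]. *)
Let Phi u (l : R) := f' (1 / l) * (u - 1 / l) + f (1 / l).

(** The two terms in [f' (1 / l) / l ^+ 2] cancel, so only [f''] survives. *)
Let is_derive_Phi u (l : R) : 0 < l -> is_derive l 1 (Phi u) (k l * (1 - l * u)).
Proof.
move=> l0; have l0' : l != 0 by rewrite gt_eqF.
have il0 : 0 < 1 / l by rewrite divr_gt0.
have dinv : is_derive l 1 (fun x : R => 1 / x) (- (l ^- 2)).
  rewrite (_ : (fun x : R => 1 / x) = (fun x => x^-1)); last first.
    by apply/funext => x; rewrite div1r.
  have := @is_deriveV R id l 1 1 l0' (is_derive_id _ _).
  by rewrite /GRing.scale/= mulr1.
have d0 : is_derive l 1 (fun x : R => f (1 / x)) (f' (1 / l) * - (l ^- 2)).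
  exact: (@is_derive1_comp _ f (fun x => 1 / x) _ _ _ (df il0) dinv).
have d1 : is_derive l 1 (fun x : R => f' (1 / x)) (f'' (1 / l) * - (l ^- 2)).
  exact: (@is_derive1_comp _ f' (fun x => 1 / x) _ _ _ (df' il0) dinv).
apply: is_derive_eq; rewrite /GRing.scale/= /k.
by field.
Qed.

(** At [u = 0] the derivative of [Phi u] is exactly [k], so the weight is itself a derivative. *)
Lemma measurable_PR_weight : measurable_fun (posreals R) k.
Proof.
apply: (@measurable_derivative _ (Phi 0)) => l l0.
by have := is_derive_Phi 0 l0; rewrite mulr0 subr0 mulr1.
Qed.

Lemma PR_weight_ge0 l : 0 < l -> 0 <= k l.
Proof.
move=> l0; rewrite mulr_ge0 ?f''_ge0 ?divr_gt0//.
by rewrite divr_ge0// exprn_ge0// ltW.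
Qed.

Let measurable_k_itv (a b : R) (h : R -> R) : 0 < a -> measurable_fun setT h ->
  measurable_fun `[a, b] (fun l => k l * h l).
Proof.
move=> a0 mh; apply: measurable_funM; last exact: measurable_funTS.
apply: measurable_funS measurable_PR_weight; first exact: measurable_itv.
by apply: subset_itv; rewrite bnd_simp.
Qed.

Lemma integral_PR_gap (m M u : R) : 0 < m -> m <= 1 -> 1 <= M -> 0 < u ->
  m <= 1 / u <= M ->
  (\int[lebesgue_measure]_(l in `[m, M]) (k l * PR_gap l u)%:E =
   (f u - f' 1 * (u - 1))%:E)%E.
Proof.
move=> m0 m1 M1 u0 /andP[mu uM].
have u0' : u != 0 by rewrite gt_eqF.
have Phi1 : Phi u 1 = f' 1 * (u - 1) by rewrite /Phi divr1 f_at1 addr0.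
have Phiu : Phi u (1 / u) = f u.
  by rewrite /Phi div1r div1r invrK subrr mulr0 add0r.
have [u1|u1] := leP 1 u.
(* For [u >= 1] the gap is [l * u - 1] on [[1 / u, 1]] and vanishes elsewhere, so the antiderivative
   is [- Phi u]. *)
- have iu1 : 1 / u <= 1 by rewrite ler_pdivrMr// mul1r.
  rewrite (@integral_support_subset _ _ _ (@lebesgue_measure R)
    `[1 / u, 1]%classic); last 2 first.
  + by apply: subset_itv; rewrite bnd_simp.
  + move=> l /=; rewrite !in_itv/= => /andP[ml lM] /negP; rewrite negb_and -!ltNge.
    move=> /orP[lu|l1].
      rewrite PR_gapE1 ?(le_trans (ltW lu))// max_r ?subrr ?mulr0//.
      by rewrite -ler_pdivlMr// ltW.
    rewrite PR_gapE2// max_l ?subrr ?mulr0//.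
    by rewrite -(mul1r 1) ler_pM// ltW.
  transitivity (\int[lebesgue_measure]_(l in `[(1 / u)%R, 1%R])
      (k l * (l * u - 1))%:E)%E.
    apply: eq_integral => l; rewrite inE/= in_itv/= => /andP[ul l1].
    by rewrite PR_gapE1// max_l// -ler_pdivrMr.
  rewrite (_ : f u - _ = - Phi u 1 - - Phi u (1 / u)); last first.
    by rewrite Phi1 Phiu; ring.
  apply: (@integral_derivative _ (fun l => - Phi u l)) => //.
  + apply: measurable_k_itv; first by rewrite divr_gt0.
    by apply: measurable_funB => //; exact: measurable_funM.
  + move=> l; rewrite in_itv/= => /andP[ul l1].
    rewrite mulr_ge0 ?PR_weight_ge0 ?(lt_le_trans _ ul) ?divr_gt0//.
    by rewrite subr_ge0 -ler_pdivrMr.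
  + move=> l; rewrite in_itv/= => /andP[ul l1].
    have l0 : 0 < l by rewrite (lt_le_trans _ ul) ?divr_gt0.
    have dPhi := is_derive_Phi u l0.
    by apply: is_derive_eq; ring.
- have iu1 : 1 <= 1 / u by rewrite ler_pdivlMr// mul1r ltW.
  (* The interval is open at 1: there the gap takes its [l <= 1] branch and is 0, whereas
     [1 - l * u] is not. The endpoint is put back as a null set before integrating. *)
  rewrite (@integral_support_subset _ _ _ (@lebesgue_measure R)
    `]1, 1 / u]%classic); last 2 first.
  + by apply: subset_itv; rewrite bnd_simp.
  + move=> l /=; rewrite !in_itv/= => /andP[ml lM] /negP.
    rewrite negb_and -ltNge -leNgt.
    move=> /orP[l1|lu].
      rewrite PR_gapE1// max_r ?subrr ?mulr0//.
      by rewrite -(mul1r 1) ler_pM// ltW// (lt_le_trans m0).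
    rewrite PR_gapE2 ?(le_lt_trans iu1 lu)// max_l ?subrr ?mulr0//.
    by rewrite -ler_pdivrMr// ltW.
  transitivity (\int[lebesgue_measure]_(l in `]1%R, (1 / u)%R])
      (k l * (1 - l * u))%:E)%E.
    apply: eq_integral => l; rewrite inE/= in_itv/= => /andP[l1 lu].
    by rewrite PR_gapE2// max_r// -ler_pdivlMr.
  have mk : measurable_fun `[1, 1 / u] (fun l => k l * (1 - l * u)).
    apply: measurable_k_itv => //.
    by apply: measurable_funB => //; exact: measurable_funM.
  rewrite integral_itv_obnd_cbnd; last first.
    by apply/measurable_EFinP; apply: measurable_funS mk => //;
      exact: subset_itv_oc_cc.
  rewrite -Phi1 -Phiu; apply: (@integral_derivative _ (Phi u)) => //.
  + move=> l; rewrite in_itv/= => /andP[l1 lu].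
    rewrite mulr_ge0 ?PR_weight_ge0 ?(lt_le_trans _ l1)//.
    by rewrite subr_ge0 -ler_pdivlMr.
  + move=> l; rewrite in_itv/= => /andP[l1 lu].
    by apply: is_derive_Phi; rewrite (lt_le_trans _ l1).
Qed.

End pointwise_formula.

(** * Passage to densities: integrability, affine corrections and Tonelli's theorem *)

(** A division-free form of [b * PR_gap l (a / b)]: it is jointly measurable on the whole space and
    is 0 where both densities vanish. *)
Definition PR_excess (R : realType) (l a b : R) : R :=
  Num.max (l * a) b - (if l <= 1 then b else l * a).

Lemma PR_excess_ge0 (R : realType) (l a b : R) : 0 <= PR_excess l a b.
Proof. by rewrite /PR_excess subr_ge0 le_max; case: ifP; rewrite lexx ?orbT. Qed.

Lemma PR_excess_le (R : realType) (l a b : R) : 0 <= l -> 0 <= a -> 0 <= b ->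
  PR_excess l a b <= l * a + b.
Proof.
move=> l0 a0 b0; have la0 := mulr_ge0 l0 a0.
rewrite /PR_excess lerBlDr; apply: (@le_trans _ _ (l * a + b)).
  by rewrite ge_max lerDl lerDr la0 b0.
by rewrite lerDl; case: ifP.
Qed.

Lemma PR_excessE (R : realType) (l a b : R) : 0 < b ->
  PR_excess l a b = b * PR_gap l (a / b).
Proof.
move=> b0; have E : b * Num.max (l * (a / b)) 1 = Num.max (l * a) b.
  rewrite maxr_pMr ?ltW// mulr1; congr (Num.max _ _).
  by field; rewrite gt_eqF.
rewrite /PR_excess; have [l1|l1] := leP l 1.
  by rewrite PR_gapE1// mulrBr E mulr1.
rewrite PR_gapE2// mulrBr E; congr (_ - _).
by field; rewrite gt_eqF.
Qed.

Lemma measurable_PR_excess d (T : measurableType d) (R : realType)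
    (l a b : T -> R) :
  measurable_fun setT l -> measurable_fun setT a -> measurable_fun setT b ->
  measurable_fun setT (fun t => PR_excess (l t) (a t) (b t)).
Proof.
move=> ml ma mb; have mla : measurable_fun setT (fun t => l t * a t).
  exact: measurable_funM.
apply: measurable_funB; first exact: measurable_maxr.
by apply: measurable_fun_ifT => //; exact: measurable_fun_ler.
Qed.

Section two_densities.
Context (R : realType) (d : nat) (X : set (Rd R d)) (p q : Rd R d -> R).
Hypothesis mp : measurable_fun setT p.
Hypothesis mq : measurable_fun setT q.
Hypothesis p_ge0 : forall x, 0 <= p x.
Hypothesis q_ge0 : forall x, 0 <= q x.
Hypothesis p_support : density_support p = X.
Hypothesis q_support : density_support q = X.
Let mu := lebesgue_Rd R d.
Hypothesis int_p : (\int[mu]_(x in X) (p x)%:E = 1)%E.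
Hypothesis int_q : (\int[mu]_(x in X) (q x)%:E = 1)%E.

Lemma density_gt0l x : X x -> 0 < p x. Proof. by rewrite -p_support. Qed.

Lemma density_gt0r x : X x -> 0 < q x. Proof. by rewrite -q_support. Qed.

Lemma measurable_density_support : measurable X.
Proof.
rewrite -p_support (_ : density_support p = p @^-1` `]0, +oo[).
  by rewrite -[X in measurable X]setTI; apply: mp => //; exact: measurable_itv.
by apply/seteqP; split => x /=; rewrite in_itv/= andbT.
Qed.

Let mX := measurable_density_support.

Let integrable_density (r : Rd R d -> R) : measurable_fun setT r ->
  (forall x, 0 <= r x) -> (\int[mu]_(x in X) (r x)%:E = 1)%E ->
  mu.-integrable X (EFin \o r).
Proof.
move=> mr r0 ir; apply/integrableP; split.
  by apply/measurable_EFinP; exact: measurable_funTS.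
under eq_integral do rewrite /= ger0_norm//.
by rewrite ir ltry.
Qed.

Let ip := integrable_density mp p_ge0 int_p.
Let iq := integrable_density mq q_ge0 int_q.

Lemma integrable_le_densities (h : Rd R d -> R) (a b : R) :
  measurable_fun X h -> (forall x, X x -> `|h x| <= a * p x + b * q x) ->
  mu.-integrable X (EFin \o h).
Proof.
move=> mh hle.
have i1 : mu.-integrable X (fun x => (a * p x + b * q x)%:E).
  have := integrableD mX (integrableZl mX a ip) (integrableZl mX b iq).
  by [].
apply: le_integrable i1 => //; first exact/measurable_EFinP.
move=> x Xx; rewrite /= lee_fin (le_trans (hle _ Xx))//; exact: ler_norm.
Qed.

(** Multiplied by [q], the extra term becomes [c * (p - q)], and both densities have integral 1 over
    [X]. Integrability of the [g] term allows the integral to be split. *)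
Lemma f_divergence_affine (g h : R -> R) (c : R) :
  mu.-integrable X (fun x => (q x * g (p x / q x))%:E) ->
  (forall u, 0 < u -> h u = g u + c * (u - 1)) ->
  f_divergence X h p q = f_divergence X g p q.
Proof.
move=> ig hg; rewrite /f_divergence.
have -> : (\int[mu]_(x in X) (q x * h (p x / q x))%:E =
    \int[mu]_(x in X) ((q x * g (p x / q x))%:E + c%:E * ((p x)%:E - (q x)%:E)))%E.
  apply: eq_integral => x /set_mem Xx; rewrite -EFinB -EFinM -EFinD hg.
    by congr (_%:E); field; rewrite gt_eqF// density_gt0r.
  by rewrite divr_gt0 ?density_gt0r ?density_gt0l.
rewrite integralD//; last by apply: integrableZl => //; exact: integrableB.
rewrite integralZl//; last exact: integrableB.
by rewrite integralB_EFin// int_p int_q subee// mule0 adde0.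
Qed.

Lemma measurable_density_ratio (g : R -> R) : measurable_fun (posreals R) g ->
  measurable_fun X (fun x => q x * g (p x / q x)).
Proof.
move=> mg; apply: measurable_funM; first exact: measurable_funTS.
apply: (@measurable_comp _ _ _ _ _ _ (posreals R)) => //.
- exact: measurable_itv.
- move=> _ [x Xx <-]; apply: set_mem.
  by rewrite posrealsE divr_gt0 ?density_gt0r ?density_gt0l.
apply: measurable_funM; first exact: measurable_funTS.
apply: (@measurable_comp _ _ _ _ _ _ (posreals R) (@GRing.inv R)).
- exact: measurable_itv.
- by move=> _ [x Xx <-]; apply: set_mem; rewrite posrealsE density_gt0r.
- apply: open_continuous_measurable_fun => // x; rewrite posrealsE => x0.
  by apply: inv_continuous; rewrite gt_eqF.
- exact: measurable_funTS.
Qed.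

(** [f_PR l] and [PR_gap l] differ by a multiple of [u - 1], and the gap term is integrable because
    it lies between 0 and [l * p + q]. *)
Lemma PR_divergenceE (l : R) : 0 < l ->
  PR_divergence X l p q = (\int[mu]_(x in X) (PR_excess l (p x) (q x))%:E)%E.
Proof.
move=> l0; have ql x : X x -> q x * PR_gap l (p x / q x) = PR_excess l (p x) (q x).
  by move=> Xx; rewrite PR_excessE// density_gt0r.
transitivity (f_divergence X (PR_gap l) p q); last first.
  by apply: eq_integral => x /set_mem Xx; rewrite ql.
apply: (@f_divergence_affine _ _ (if l <= 1 then 0 else l)); last first.
  by move=> u _; rewrite /PR_gap subrK.
apply: (@eq_integrable _ _ _ mu X mX (EFin \o (fun x => PR_excess l (p x) (q x)))).
  by move=> x /set_mem Xx; rewrite /= ql.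
apply: (@integrable_le_densities _ l 1).
  by apply: measurable_funTS; exact: measurable_PR_excess.
by move=> x Xx; rewrite ger0_norm ?PR_excess_ge0// mul1r PR_excess_le// ltW.
Qed.

(** Tonelli's theorem for a nonnegative function on the full product space: [k] is extended by 0
    outside [[m, M]], and the excess already vanishes off [X]. Integrating first in [l] gives [g],
    first in [x] gives the PR-divergences. *)
Lemma PR_mixture_divergence (k g : R -> R) (m M : R) :
  0 < m -> measurable_fun `[m, M] k -> (forall l, l \in `[m, M] -> 0 <= k l) ->
  (forall x, X x -> (\int[lebesgue_measure]_(l in `[m, M])
      (k l * PR_gap l (p x / q x))%:E = (g (p x / q x))%:E)%E) ->
  f_divergence X g p q = (\int[lebesgue_measure]_(l in `[m, M])
      ((k l)%:E * PR_divergence X l p q))%E.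
Proof.
move=> m0 mk k0 kg; pose K := k \_ `[m, M].
have mK : measurable_fun setT K.
  exact: (@measurable_restrictT _ _ _ _ `[m, M]%classic k (measurable_itv _)).1.
have KE l : l \in `[m, M] -> K l = k l by move=> lmM; rewrite /K patchE mem_set.
have K0 l : l \notin `[m, M] -> K l = 0.
  move=> /negP lmM; rewrite /K patchE memNset//.
have K_ge0 l : 0 <= K l.
  by have [lmM|/K0 ->//] := boolP (l \in `[m, M]); rewrite KE// k0.
pose F (z : measurableTypeR R * Rd R d) :=
  (K z.1 * PR_excess z.1 (p z.2) (q z.2))%:E.
have mE (l : R) : measurable_fun setT (fun x => (PR_excess l (p x) (q x))%:E).
  by apply/measurable_EFinP; exact: measurable_PR_excess.
have E0 (l : R) x : ~ X x -> PR_excess l (p x) (q x) = 0.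
  move=> Xx; have -> : p x = 0.
    by apply/eqP; rewrite eq_le p_ge0 andbT leNgt; apply/negP => H;
       apply: Xx; rewrite -p_support.
  have -> : q x = 0.
    by apply/eqP; rewrite eq_le q_ge0 andbT leNgt; apply/negP => H;
       apply: Xx; rewrite -q_support.
  by rewrite /PR_excess mulr0 maxxx if_same subrr.
have mF : measurable_fun setT F.
  apply/measurable_EFinP/measurable_funM.
    exact: (measurableT_comp mK measurable_fst).
  apply: measurable_PR_excess; first exact: measurable_fst.
    exact: (measurableT_comp mp measurable_snd).
  exact: (measurableT_comp mq measurable_snd).
have F0 z : (0 <= F z)%E by rewrite lee_fin mulr_ge0// PR_excess_ge0.
transitivity (\int[mu]_x \int[@lebesgue_measure R]_l F (l, x))%E; last first.
  rewrite -fubini_tonelli// [RHS]integral_mkcond; apply: eq_integral => l _.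
  rewrite patchE; case: ifPn => [/set_mem lmM|lmM]; last first.
    rewrite -[RHS](integral0 mu setT); apply: eq_integral => x _.
    rewrite /F/= K0 ?mul0r//; apply/negP => H.
    by move/negP: lmM; apply; rewrite mem_set.
  rewrite PR_divergenceE; last first.
    by move: lmM; rewrite /= in_itv/= => /andP[+ _]; exact: lt_le_trans.
  rewrite -(@integral_support_subset _ _ _ mu X setT)//; last first.
    by move=> x _ Xx; rewrite E0.
  rewrite -ge0_integralZl_EFin//; last 2 first.
  - by move=> x _; rewrite lee_fin PR_excess_ge0.
  - exact: k0.
  by apply: eq_integral => x _; rewrite /F/= KE.
rewrite (@integral_support_subset _ _ _ mu X setT)//; last first.
  move=> x _ Xx; rewrite -[RHS](integral0 lebesgue_measure setT).
  by apply: eq_integral => l _; rewrite /F/= E0// mulr0.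
apply: eq_integral => x /set_mem Xx.
rewrite (@integral_support_subset _ _ _ lebesgue_measure `[m, M]%classic
  setT)//; last first.
  by move=> l _ /negP lmM; rewrite /F/= K0// mul0r.
have q0 := density_gt0r Xx.
rewrite EFinM -kg// -ge0_integralZl_EFin//; last 2 first.
- by move=> l lmM; rewrite lee_fin mulr_ge0 ?PR_gap_ge0 ?k0.
- apply/measurable_EFinP/measurable_funM => //; apply: measurable_funTS.
  (* Measurability of the gap in [l] comes from reading it as an excess with second density equal to
     1. *)
  under eq_fun do rewrite -[_ / _]divr1 -[PR_gap _ _]mul1r -PR_excessE//.
  exact: measurable_PR_excess.
by apply: eq_integral => l /set_mem lmM; rewrite /F/= KE// PR_excessE// mulrCA.
Qed.

End two_densities.

(** * Assembly: bounds on [m] and [M], subtraction of the tangent at 1, and the mixture formula *)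

Unset Implicit Arguments.

Theorem theorem4p4 (R : realType) (d : nat) (X : set (Rd R d)) (f : R -> R)
    (P Phat : probability (Rd R d) R) (p phat : Rd R d -> R) (m M : R)
    (f_convex : convex_on_posreals f)
    (f_lsc : lsc_on_posreals f)
    (f_at1 : f 1 = 0)
    (f_twice : twice_derivable_on_posreals f)
    (P_density : is_density P p)
    (Phat_density : is_density Phat phat)
    (P_support : density_support p = X)
    (Phat_support : density_support phat = X)
    (m_min : is_minimum X (fun x => phat x / p x) m)
    (M_max : is_maximum X (fun x => phat x / p x) M) :
  f_divergence X f p phat =
    (\int[lebesgue_measure]_(lambda in `[m, M])
       ((1 / lambda ^+ 3 * derive1n 2 f (1 / lambda))%:E *
        PR_divergence X lambda p phat))%E.
Proof.
case: P_density => mp p0 Pp; case: Phat_density => mq q0 Pq.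
have int1 (r : Rd R d -> R) (Q : probability (Rd R d) R) : (forall x, 0 <= r x) ->
    density_support r = X ->
    Q setT = (\int[lebesgue_Rd R d]_x (r x)%:E)%E ->
    (\int[lebesgue_Rd R d]_(x in X) (r x)%:E = 1)%E.
  move=> r0 rX Qr.
  rewrite -(@integral_support_subset _ _ _ (lebesgue_Rd R d) X setT)//.
    by rewrite -Qr probability_setT.
  move=> x _ Xx; congr (_%:E); apply/eqP; rewrite eq_le r0 andbT leNgt.
  by apply/negP => rx; apply: Xx; rewrite -rX.
have int_p := int1 p P p0 P_support (Pp _ measurableT).
have int_q := int1 phat Phat q0 Phat_support (Pq _ measurableT).
have pX x : X x -> 0 < p x by exact: density_gt0l.
have qX x : X x -> 0 < phat x by exact: density_gt0r.
have mX : measurable X by exact: (measurable_density_support mp P_support).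
have ratio_le x : X x -> m <= phat x / p x <= M.
  move=> Xx; case: m_min => _ /(_ (phat x / p x)) -> /=; last by exists x.
  by case: M_max => _; apply; exists x.
have m0 : 0 < m by case: m_min => -[x Xx <-] _; rewrite divr_gt0 ?pX ?qX.
(* Integrating [m * p <= phat] and [phat <= M * p] over [X] will give [m <= 1 <= M], as both
   densities have mass 1. *)
have mean_le (r s : Rd R d -> R) (a b : R) : 0 <= a -> 0 <= b ->
    measurable_fun setT r -> measurable_fun setT s ->
    (forall x, 0 <= r x) -> (forall x, 0 <= s x) ->
    (forall x, X x -> a * r x <= b * s x) ->
    (\int[lebesgue_Rd R d]_(x in X) (r x)%:E = 1)%E ->
    (\int[lebesgue_Rd R d]_(x in X) (s x)%:E = 1)%E -> a <= b.
  move=> a0 b0 mr ms r0 s0 rs ir js.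
  have scale (c : R) (t : Rd R d -> R) : 0 <= c -> measurable_fun setT t ->
      (forall x, 0 <= t x) -> (\int[lebesgue_Rd R d]_(x in X) (t x)%:E = 1)%E ->
      (\int[lebesgue_Rd R d]_(x in X) (c * t x)%:E = c%:E)%E.
    move=> c0 mt t0 it; under eq_integral do rewrite EFinM.
    rewrite ge0_integralZl_EFin// ?it ?mule1//; last first.
      by apply/measurable_EFinP; exact: measurable_funTS.
    by move=> x _; rewrite lee_fin.
  rewrite -lee_fin -(scale a r)// -(scale b s)//; apply: ge0_le_integral => //.
  - by move=> x _; rewrite lee_fin mulr_ge0.
  - by apply/measurable_EFinP/measurable_funTS/measurable_funM.
  - by apply/measurable_EFinP/measurable_funTS/measurable_funM.
have m1 : m <= 1.
  apply: (mean_le p phat) => //; first exact: ltW.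
  move=> x Xx; rewrite mul1r -ler_pdivlMr ?pX//.
  by have /andP[] := ratio_le x Xx.
have M1 : 1 <= M.
  apply: (mean_le phat p) => //.
    by case: M_max => -[x Xx <-] _; rewrite divr_ge0.
  move=> x Xx; rewrite mul1r -ler_pdivrMr ?pX//.
  by have /andP[] := ratio_le x Xx.
have df (x : R) : 0 < x -> is_derive x 1 f (derive1 f x).
  rewrite -posrealsE => /f_twice[dx _].
  by rewrite derive1E; exact: derivableP.
have df' (x : R) : 0 < x -> is_derive x 1 (derive1 f) (derive1 (derive1 f) x).
  rewrite -posrealsE => /f_twice[_ dx].
  by rewrite (derive1E (derive1 f)); exact: derivableP.
have tangent := convex_tangent_le f_convex df.
(* Subtracting the tangent at 1 makes [g] nonnegative and matches the value found in
   [integral_PR_gap]. *)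
pose g u := f u - derive1 f 1 * (u - 1).
have g0 u : 0 < u -> 0 <= g u.
  by move=> u0; have := tangent 1 u ltr01 u0; rewrite /g f_at1; lra.
have f''0 (x : R) : 0 < x -> 0 <= derive1 (derive1 f) x.
  by move=> x0; exact: (convex_derivative2_ge0 f_convex df x0 (df' x x0)).
have mg : measurable_fun (posreals R) g.
  apply: measurable_funB; last first.
    by apply: measurable_funM => //; exact: measurable_funB.
  apply: open_continuous_measurable_fun => // x; rewrite posrealsE => x0.
  apply: differentiable_continuous; apply/derivable1_diffP.
  by case: (df x x0).
transitivity (f_divergence X g p phat).
  apply: (@f_divergence_affine _ _ _ _ _ mp mq p0 q0 P_support Phat_support
    int_p int_q _ _ (derive1 f 1)); last by move=> u _; rewrite /g subrK.
  (* The ratio [u] and the point 1 both lie in [[1 / M, 1 / m]], so [C] bounds the variation of the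
     monotone derivative between them. The tangent at [u], evaluated at 1, gives
     [g u <= C * |u - 1|], and [phat * |u - 1| = |p - phat| <= p + phat] is integrable. *)
  pose C := derive1 f (1 / m) - derive1 f (1 / M).
  apply: (@integrable_le_densities _ _ _ _ _ mp mq p0 q0 P_support int_p int_q
    _ C C).
    exact: measurable_density_ratio.
  move=> x Xx; have px := pX x Xx; have qx := qX x Xx.
  set u := p x / phat x; have u0 : 0 < u by rewrite divr_gt0.
  have M0 : 0 < M by exact: lt_le_trans M1.
  have /andP[mu uM] : 1 / M <= u <= 1 / m.
    have /andP[mr rM] := ratio_le x Xx.
    by rewrite /u -(invf_div (phat x)) !div1r !lef_pV2 ?posrE ?divr_gt0// rM mr.
  have iM0 : 0 < 1 / M by rewrite divr_gt0.
  have homo := convex_derivative_homo f_convex df.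
  have h1 := homo _ _ iM0 mu; have h2 := homo _ _ u0 uM.
  have h3 : derive1 f (1 / M) <= derive1 f 1.
    by apply: homo => //; rewrite ler_pdivrMr// mul1r.
  have h4 : derive1 f 1 <= derive1 f (1 / m).
    by apply: homo => //; rewrite ler_pdivlMr// mul1r.
  have gle : g u <= C * `|u - 1|.
    have : g u <= (derive1 f u - derive1 f 1) * (u - 1).
      by have := tangent u 1 u0 ltr01; rewrite /g f_at1; lra.
    move=> /le_trans; apply; apply: le_trans (ler_norm _) _.
    rewrite normrM ler_wpM2r// ler_norml /C.
    by apply/andP; split; lra.
  rewrite normrM (ger0_norm (ltW qx)) (ger0_norm (g0 u u0)).
  apply: (@le_trans _ _ (phat x * (C * `|u - 1|))); first by rewrite ler_pM2l.
  rewrite -mulrDr mulrCA ler_wpM2l//; first by rewrite /C; lra.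
  rewrite -{1}(ger0_norm (ltW qx)) -normrM.
  have -> : phat x * (u - 1) = p x - phat x by rewrite /u; field; rewrite gt_eqF.
  by apply: le_trans (ler_normB _ _) _; rewrite !ger0_norm// ltW.
apply: (@PR_mixture_divergence _ _ _ _ _ mp mq p0 q0 P_support Phat_support
  int_p int_q (fun l => 1 / l ^+ 3 * derive1 (derive1 f) (1 / l)) g).
- exact: m0.
- apply: measurable_funS (measurable_PR_weight df df'); first exact: measurable_itv.
  by apply: subset_itv; rewrite bnd_simp.
- move=> l; rewrite in_itv/= => /andP[ml _].
  by apply: PR_weight_ge0 => //; exact: lt_le_trans ml.
- move=> x Xx; apply: integral_PR_gap => //; first by rewrite divr_gt0 ?pX ?qX.
  rewrite div1r invf_div; exact: ratio_le.
Qed.
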